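(* Let $\mathbf a_1,\dots,\mathbf a_m,\mathbf x\in\mathbb R^3$ and $t_1,\dots,t_m,t\in\mathbb R$ be such that $\lVert\mathbf a_i-\mathbf x\rVert=t_i-t$ for all $i=1,\dots,m$. Write $d_{i,j}:=\lVert\mathbf a_i-\mathbf a_j\rVert$ and $t_{i,j}:=t_i-t_j$. Then the matrix $$D=\bigl(t_{i,j}^2-d_{i,j}^2\bigr)_{i,j=1,\dots,m}\in\mathbb R^{m\times m}$$ has rank $\le 4$. So if $m\ge 5$ we have the relation $\det(D)=0$, and if $m>5$ all $5\times5$-minors of $D$ are zero.
   Context: $\lVert\cdot\rVert$ denotes the Euclidean norm on $\mathbb R^3$. (Interpretation: a source at position $\mathbf x$ emits a signal at time $t$, which travels with speed $1$ and is received at times $t_1,\dots,t_m$ by sensors at positions $\mathbf a_1,\dots,\mathbf a_m$.) *)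

(* Defs.v *)
From mathcomp Require Import all_boot all_order all_algebra.
From mathcomp Require Import reals.
Set Implicit Arguments.
Unset Strict Implicit.
Unset Printing Implicit Defensive.
Import Order.TTheory GRing.Theory Num.Theory.
Local Open Scope ring_scope.

(* The norm that MathComp-Analysis puts on matrices is the sup norm, hence a
   separate definition of the Euclidean norm. *)
Definition enorm (R : realType) (n : nat) (v : 'rV[R]_n) : R :=
  Num.sqrt (\sum_(k < n) v 0 k ^+ 2).

Definition Dmx (R : realType) (m : nat) (a : 'I_m -> 'rV[R]_3)
    (t : 'I_m -> R) : 'M[R]_m :=
  \matrix_(i < m, j < m) ((t i - t j) ^+ 2 - enorm (a i - a j) ^+ 2).

(* The k x k minor of A on rows f 0 < ... < f (k-1) and columns
   g 0 < ... < g (k-1), when f and g are strictly increasing. *)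
Definition minor (R : realType) (m n k : nat) (A : 'M[R]_(m, n))
    (f : 'I_k -> 'I_m) (g : 'I_k -> 'I_n) : R :=
  \det (mxsub f g A).

(* Main.v *)
(* Put the source at the origin of space-time: with b_i = a_i - x and
   s_i = t_i - t0 we have |b_i| = s_i, so the squares cancel and
   D_ij = (s_i - s_j)^2 - |b_i - b_j|^2 = 2 (<b_i, b_j> - s_i s_j), a Gram
   matrix for the Lorentz form on R^(3+1), which factors through R^4. *)
Require Import Defs.
From mathcomp Require Import all_boot all_order all_algebra.
From mathcomp Require Import reals.
From mathcomp Require Import ring.
Set Implicit Arguments.
Unset Strict Implicit.
Unset Printing Implicit Defensive.
Import Order.TTheory GRing.Theory Num.Theory.
Local Open Scope ring_scope.

Lemma sqr_enorm (R : realType) (n : nat) (v : 'rV[R]_n) :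
  enorm v ^+ 2 = \sum_(k < n) v 0 k ^+ 2.
Proof. by rewrite sqr_sqrtr // sumr_ge0 // => k _; rewrite sqr_ge0. Qed.

(** Polarization, which trades the squared distances in [Dmx] for inner products. *)
Lemma sqr_enormB (R : realType) (n : nat) (u v : 'rV[R]_n) :
  enorm (u - v) ^+ 2 =
    enorm u ^+ 2 + enorm v ^+ 2 - 2 * \sum_(k < n) u 0 k * v 0 k.
Proof.
rewrite !sqr_enorm mulr_sumr -sumrN -!big_split; apply: eq_bigr => k _ /=.
by rewrite !mxE; ring.
Qed.

Lemma det_eq0_rank (F : fieldType) (n : nat) (A : 'M[F]_n) :
  (\rank A < n)%N -> \det A = 0.
Proof.
move=> rkA; apply/eqP; apply: contraTT rkA.
by rewrite -unitfE -unitmxE => /mxrank_unit ->; rewrite ltnn.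
Qed.

(** Selected rows span a subspace of the row space; columns are treated the same way after
    transposing. This carries the rank bound over to minors. *)
Lemma mxrank_mxsub (F : fieldType) (m n p q : nat) (A : 'M[F]_(m, n))
    (f : 'I_p -> 'I_m) (g : 'I_q -> 'I_n) :
  (\rank (mxsub f g A) <= \rank A)%N.
Proof.
rewrite mxsubrc; apply: leq_trans (mxrankS (rowsub_sub _ _)) _.
rewrite -mxrank_tr trmx_mxsub -[leqRHS]mxrank_tr.
exact: mxrankS (rowsub_sub _ _).
Qed.

(** The inner dimension is 3 + 1: three space columns in [B], one time column in [s]. The signature
    of the Lorentz form sits in the signs of the right factor. *)
Lemma Dmx_factor (R : realType) (m : nat) (a : 'I_m -> 'rV[R]_3)
    (x : 'rV[R]_3) (t : 'I_m -> R) (t0 : R) :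
  (forall i, enorm (a i - x) = t i - t0) ->
  let B := \matrix_(i, k) (a i - x) 0 k in
  let s := \col_i (t i - t0) in
  Dmx a t = row_mx B s *m col_mx (2 *: B^T) (- 2 *: s^T).
Proof.
move=> h B s; apply/matrixP => i j.
have -> : Dmx a t i j = 2 * (\sum_k (a i - x) 0 k * (a j - x) 0 k)
                        - 2 * ((t i - t0) * (t j - t0)).
  (* Recentring at [x] makes polarization produce exactly the norms that [h] evaluates. *)
  rewrite mxE; have -> : a i - a j = (a i - x) - (a j - x).
    by rewrite opprB addrA subrK.
  by rewrite sqr_enormB !h; ring.
rewrite mul_row_col -!scalemxAr scaleNr !mxE big_ord1 !mxE.
by congr (2 * _ - _); apply: eq_bigr => k _; rewrite !mxE.
Qed.

Theorem theorem2p1 (R : realType) (m : nat)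
    (a : 'I_m -> 'rV[R]_3) (x : 'rV[R]_3) (t : 'I_m -> R) (t0 : R)
    (h : forall i : 'I_m, enorm (a i - x) = t i - t0) :
  [/\ (\rank (Dmx a t) <= 4)%N,
      (5 <= m)%N -> \det (Dmx a t) = 0
    & (5 < m)%N -> forall f g : 'I_5 -> 'I_m,
        {homo f : i j / (i < j)%N} -> {homo g : i j / (i < j)%N} ->
        minor (Dmx a t) f g = 0].
Proof.
have rkD : (\rank (Dmx a t) <= 4)%N.
  rewrite (Dmx_factor h).
  exact: leq_trans (mxrankM_maxl _ _) (rank_leq_col _).
split=> // [m_ge5 | _ f g _ _]; apply: det_eq0_rank.
  exact: leq_ltn_trans rkD m_ge5.
(* The remaining bound, rank less than 5, is [rkD] up to conversion. *)
exact: leq_ltn_trans (mxrank_mxsub _ f g) _.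
Qed.
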